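(* Let $\bar t\in(0,\tfrac12)$, let $\varepsilon\in\big(0,\tfrac{2\bar t}{1+2\bar t}\big)$, let $R:[0,\bar t]\to\mathbb{R}_{\ge 0}$ be non-decreasing, and let $F\in\mathcal{H}_{\bar t,R}$. Let $Y_i\sim F$ and $D_i\sim\mathrm{Ber}(\varepsilon)$, for $i\in[n]$, all be drawn independently. Let $\{Z_i\}_{i\in[n]}$ be arbitrary random variables possibly depending on $\{Y_i,D_i\}_{i\in[n]}$, and define $X_i=(1-D_i)Y_i+D_iZ_i$. Then, for any confidence level $\delta\in(0,1)$ and any number of samples $n\ge 2\left(\bar t-\tfrac{\varepsilon}{2(1-\varepsilon)}\right)^{-2}\log\tfrac{2}{\delta}$, $$\mathbb{P}\left(\sup_{m\in m_1(F)}\left|\hat m_1(X_1,\dots,X_n)-m\right|\le R\left(\frac{\varepsilon}{2(1-\varepsilon)}+\sqrt{\frac{2\log(2/\delta)}{n}}\right)\right)\ge 1-\delta .$$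
   Context: Distributions are on $\mathbb{R}$ and identified with their cdfs; $[n]=\{1,\dots,n\}$. For a cdf $F$, the left and right quantiles are $Q_{L,F}(p)=\inf\{x\in\mathbb{R}:F(x)\ge p\}$ and $Q_{R,F}(p)=\inf\{x\in\mathbb{R}:F(x)>p\}$. The set of medians of $F$ is $m_1(F)=[Q_{L,F}(\tfrac12),Q_{R,F}(\tfrac12)]$. The empirical median $\hat m_1(x_1,\dots,x_n)$ is the middle value if $n$ is odd and the average of the two middle values if $n$ is even. For $\bar t\in(0,\tfrac12)$ and a non-decreasing function $R:[0,\bar t]\to\mathbb{R}_{\ge0}$, $\mathcal{H}_{\bar t,R}$ is the family of all distributions $F$ satisfying $$R(t)\ge\max\left\{Q_{R,F}\left(\tfrac12+t\right)-m,\; m-Q_{L,F}\left(\tfrac12-t\right)\right\}$$ for every $t\in[0,\bar t]$ and every median $m\in m_1(F)$. *)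

(* Defs.v *)
From mathcomp Require Export all_boot all_order all_algebra.
From mathcomp Require Export all_classical all_reals all_analysis.
Import Order.TTheory GRing.Theory Num.Theory.
Import numFieldNormedType.Exports.

Set Implicit Arguments.
Unset Strict Implicit.
Unset Printing Implicit Defensive.

Local Open Scope classical_set_scope.
Local Open Scope ring_scope.

(* The real-valued [inf] is the genuine infimum for 0 < p < 1, where the two
   sets below are nonempty and bounded from below when F is a cdf. *)
Definition quantileL {R : realType} (F : R -> R) (p : R) : R :=
  inf [set x : R | p <= F x].

Definition quantileR {R : realType} (F : R -> R) (p : R) : R :=
  inf [set x : R | p < F x].

Definition medians {R : realType} (F : R -> R) : set R :=
  `[quantileL F (1 / 2), quantileR F (1 / 2)].

(* With s_0 <= ... <= s_(n-1) the sorted sample, the two middle values for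
   even n are s_(n/2 - 1) and s_(n/2). *)
Definition empirical_median {R : realType} (n : nat) (x : 'I_n -> R) : R :=
  let s := sort <=%R (codom x) in
  if odd n then s`_(n./2) else (s`_(n./2.-1) + s`_(n./2)) / 2.

(* The class H_{tb, rad}; [rad] is only evaluated on [0, tb]. *)
Definition quantile_class {R : realType} (tb : R) (rad : R -> R)
    (F : R -> R) : Prop :=
  forall t m : R, 0 <= t <= tb -> medians F m ->
    Num.max (quantileR F (1 / 2 + t) - m) (m - quantileL F (1 / 2 - t))
      <= rad t.

Definition independent_systems {d : measure_display} {T : measurableType d}
    {R : realType} (P : probability T R) (I : finType)
    (E : I -> set (set T)) : Prop :=
  forall (J : {set I}) (A : I -> set T),
    (forall i, i \in J -> E i (A i)) ->
    P (\bigcap_(i in [set` J]) A i) = (\prod_(i in J) P (A i))%E.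

(* Mutual independence of all the variables U_i, V_j taken together, through
   the sigma-algebras they generate. *)
Definition independent_two_families {d d1 d2 : measure_display}
    {T : measurableType d} {T1 : measurableType d1} {T2 : measurableType d2}
    {R : realType} (P : probability T R) (I J : finType)
    (U : I -> {RV P >-> T1}) (V : J -> {RV P >-> T2}) : Prop :=
  independent_systems P (fun k : I + J =>
    match k with
    | inl i => preimage_set_system setT (U i) measurable
    | inr j => preimage_set_system setT (V j) measurable
    end).

(* Main.v *)
From mathcomp Require Import ring lra zify measurable_realfun.
Require Import Defs.
Import Order.TTheory GRing.Theory Num.Theory.
Import numFieldNormedType.Exports.
Local Open Scope classical_set_scope.
Local Open Scope ring_scope.

(* Put t = eps / (2 (1 - eps)) + s with s = sqrt (2 log (2 / delta) / n). An
   empirical median above q = Q_R(1/2 + t) forces at most n/2 of the X_i to be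
   <= q, hence at most n/2 of the independent events
   {D_i = 0, Y_i <= q} to occur, whatever the Z_i are. Each of these has
   probability at least (1 - eps) (1/2 + t) = 1/2 + (1 - eps) s, so Chernoff's
   bound gives probability at most exp (- 2 n (1 - eps)^2 s^2), which is at most
   delta / 2 because tb < 1/2 forces eps < 1/2. An empirical median below
   Q_L(1/2 - t) is symmetric, and between these two quantiles the error is
   bounded by the definition of the class. *)

(** * Chernoff bound for independent events *)

(** Expanding the product over subsets [J] turns each monomial of indicators into the indicator of
    an intersection, whose probability factors by independence. With [c = y - 1] the integrand is
    [y] to the number of occurring events. *)
Lemma independent_generating_function (R : realType) (d : measure_display)
    (T : measurableType d) (P : probability T R) (I : finType)
    (B : I -> set T) (c : R) :
  (forall i, measurable (B i)) ->
  independent_systems P (fun i => [set B i]) ->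
  (\int[P]_w (\prod_i (1 + c * \1_(B i) w))%:E =
   (\prod_i (1 + c * fine (P (B i))))%:E)%E.
Proof.
move=> mB indB.
pose BJ (J : {set I}) := \bigcap_(i in [set` J]) B i.
have mBJ J : measurable (BJ J).
  by apply: fin_bigcap_measurable => // i _; exact: mB.
have PBJ J : fine (P (BJ J)) = \prod_(i in J) fine (P (B i)).
  rewrite indB //.
  transitivity (fine (\prod_(i in J) (fine (P (B i)))%:E)%E).
    congr fine; apply: eq_bigr => i _; rewrite fineK//; exact: fin_num_measure.
  by rewrite prodEFin.
have expand (x : I -> R) :
    \prod_i (1 + c * x i) = \sum_(J : {set I}) c ^+ #|J| * \prod_(i in J) x i.
  under eq_bigr do rewrite addrC.
  rewrite bigA_distr; apply: eq_bigr => J _.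
  by rewrite -big_mkcond /= big_split /= prodr_const.
have indicBJ (J : {set I}) w : \prod_(i in J) \1_(B i) w = \1_(BJ J) w :> R.
  have [wJ|wJ] := pselect (BJ J w).
    rewrite indicE mem_set// big1// => i iJ; rewrite indicE mem_set//.
    exact: wJ.
  rewrite [RHS]indicE memNset//.
  have [i iJ niw] : exists2 i, i \in J & ~ B i w.
    apply: contrapT => h; apply: wJ => i iJ; apply: contrapT => nB.
    by apply: h; exists i.
  by rewrite (bigD1 i)//= indicE memNset ?mul0r.
transitivity (\int[P]_w \sum_(J : {set I}) ((c ^+ #|J|)%:E * (\1_(BJ J) w)%:E))%E.
  apply: eq_integral => w _; rewrite expand -sumEFin.
  by apply: eq_bigr => J _; rewrite indicBJ EFinM.
rewrite integral_sum//; last first.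
  by move=> J; apply: integrableZl => //; exact: integrable_indic.
rewrite expand -sumEFin; apply: eq_bigr => J _.
rewrite integralZl//; last exact: integrable_indic.
rewrite integral_indic// setIT -PBJ EFinM fineK//; exact: fin_num_measure.
Qed.

(** The count depends only on which events occur, so the set is a finite union, over index sets [J],
    of finite intersections of the [B i] and their complements. *)
Lemma measurable_card (d : measure_display) (T : measurableType d)
    (I : finType) (B : I -> set T) (Q : pred nat) :
  (forall i, measurable (B i)) ->
  measurable [set w | Q #|[set i | w \in B i]%SET|].
Proof.
move=> mB.
rewrite [X in measurable X](_ : _ =
    \bigcup_(J in [set J : {set I} | Q #|J|])
      \bigcap_(i in [set: I]) (if i \in J then B i else ~` B i)); last first.
  apply/seteqP; split=> [w Qw|w [J QJ wJ]] /=.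
    exists [set i | w \in B i]%SET => // i _; rewrite inE.
    by case: ifP => [/set_mem//|/negP nB] Bi; apply: nB; exact/mem_set.
  suff -> : [set i | w \in B i]%SET = J by []; apply/setP => i; rewrite inE.
  have := wJ i Logic.I.
  by case: ifP => _ Bi; [exact/mem_set|exact/memNset].
apply: fin_bigcup_measurable => [|J _]; first exact: finite_finset.
apply: fin_bigcap_measurable => [|i _]; first exact: finite_finset.
by case: ifP => _; [exact: mB|exact: measurableC].
Qed.

(* Chernoff's method, with the moment generating function of the number of
   occurring events evaluated at its minimizer ln y. *)
Lemma few_independent_events (R : realType) (d : measure_display)
    (T : measurableType d) (P : probability T R) (I : finType)
    (B : I -> set T) (h : R) :
  0 <= h < 1 / 2 ->
  (forall i, measurable (B i)) ->
  independent_systems P (fun i => [set B i]) ->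
  (forall i, ((1 / 2 + h)%:E <= P (B i))%E) ->
  (P [set w | (2 * #|[set i | w \in B i]%SET| <= #|I|)%N] <=
   (expR (- (2 * h ^+ 2 * #|I|%:R)))%:E)%E.
Proof.
move=> /andP[h0 h2] mB indB Bge.
pose y : R := (1 - 2 * h) / (1 + 2 * h).
have hp : 0 < 1 + 2 * h by lra.
have y0 : 0 < y by rewrite divr_gt0//; lra.
have y1 : y <= 1 by rewrite ler_pdivrMr//; lra.
(* The threshold is half of [#|I|]. Working with powers of [u] and doubled counts keeps the
   exponents integral whatever the parity of [#|I|]. *)
pose u := Num.sqrt y.
have u0 : 0 < u by rewrite sqrtr_gt0.
have u1 : u <= 1 by rewrite -(sqrtr1 R) ler_sqrt.
have u2 : u ^+ 2 = y by rewrite sqr_sqrtr// ltW.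
pose N w := #|[set i | w \in B i]%SET|.
pose bad := [set w | (2 * N w <= #|I|)%N].
have mbad : measurable bad by exact: (measurable_card _ _ _ _ (fun k => 2 * k <= #|I|)%N).
have gE w : \prod_i (1 + (y - 1) * \1_(B i) w) = u ^+ (2 * N w).
  rewrite exprM u2 -prodr_const [RHS]big_mkcond /=; apply: eq_bigr => i _.
  rewrite inE indicE; case: (w \in B i) => /=; lra.
have mg : measurable_fun setT (fun w => \prod_i (1 + (y - 1) * \1_(B i) w)).
  apply: measurable_prod => i _; apply: measurable_funD => //.
  apply: measurable_funM => //; exact: measurable_indic.
have markov : ((u ^+ #|I|)%:E * P bad <=
    \int[P]_w (\prod_i (1 + (y - 1) * \1_(B i) w))%:E)%E.
  have -> : (P bad = \int[P]_w (\1_bad w)%:E)%E by rewrite integral_indic// setIT.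
  rewrite -integralZl//; last exact: integrable_indic.
  apply: ge0_le_integral => //.
  - by move=> w _; rewrite -EFinM lee_fin mulr_ge0// exprn_ge0// ltW.
  - apply/measurable_EFinP; apply: measurable_funM => //; exact: measurable_indic.
  - by apply/measurable_EFinP.
  - move=> w _; rewrite -EFinM lee_fin gE indicE.
    have [/set_mem badw|_] := boolP (w \in bad); last by rewrite mulr0 exprn_ge0// ltW.
    by rewrite mulr1 ler_wiXn2l// ltW.
(* Since [y <= 1], each factor decreases in [P (B i)], so it is largest at [1 / 2 + h], where it
   equals [1 - 2 * h]. *)
have prod_le : \prod_i (1 + (y - 1) * fine (P (B i))) <= (1 - 2 * h) ^+ #|I|.
  rewrite -prodr_const; apply: ler_prod => i _.
  have Bfin : P (B i) \is a fin_num by exact: fin_num_measure.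
  have B1 : fine (P (B i)) <= 1 by rewrite -lee_fin fineK// probability_le1.
  have B2 : 1 / 2 + h <= fine (P (B i)) by rewrite -lee_fin fineK.
  apply/andP; split; first by nra.
  apply: (@le_trans _ _ (1 + (y - 1) * (1 / 2 + h))); first by nra.
  by rewrite le_eqVlt; apply/orP; left; apply/eqP; rewrite /y; field; lra.
rewrite independent_generating_function// in markov.
rewrite -(fineK (fin_num_measure P _ mbad)) in markov *.
set p := fine (P bad) in markov *.
rewrite -EFinM !lee_fin in markov *.
have {}markov : p <= ((1 - 2 * h) / u) ^+ #|I|.
  rewrite expr_div_n ler_pdivlMr ?exprn_gt0// mulrC.
  exact: le_trans markov prod_le.
apply: (le_trans markov).
rewrite (_ : - (2 * h ^+ 2 * #|I|%:R) = (- (2 * h ^+ 2)) * #|I|%:R); last by ring.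
rewrite expRM_natr.
have r0 : 0 <= (1 - 2 * h) / u by rewrite divr_ge0//; [lra|exact: ltW].
apply: lerXn2r; rewrite ?nnegrE ?expR_ge0//.
(* Squaring removes the root [u]: what remains is [1 - 4 * h ^+ 2 <= expR (- (4 * h ^+ 2))]. *)
rewrite -(@ler_pXn2r _ 2)// ?nnegrE ?expR_ge0// -expRM_natr expr_div_n u2.
have -> : (1 - 2 * h) ^+ 2 / y = 1 - 4 * h ^+ 2.
  by rewrite /y; field; apply/andP; split; lra.
apply: le_trans (expR_ge1Dx _); lra.
Qed.

(** * Values of a cdf at and below its quantiles *)

(** If [F] were below [p] at the quantile, right continuity would keep it below [p] just to the
    right, where points with [F > p] must accumulate. The limits of [F] at both infinities make the
    infimum genuine. *)
Lemma cdf_quantileR_ge (R : realType) (F : cumulativeBounded (0 : R) (1 : R))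
    (p : R) :
  0 < p < 1 -> p <= F (quantileR F p).
Proof.
move=> /andP[p0 p1].
have hinf : has_inf [set x : R | p < F x].
  split.
    have [x Fx] := filter_ex (cvgr_gt _ (cumulativey F) _ p1).
    by exists x.
  have [x Fx] := filter_ex (cvgr_lt _ (cumulativeNy F) _ p0).
  exists x => z /= Fz; rewrite leNgt; apply/negP => zx.
  by have := cumulative_is_nondecreasing F _ _ (ltW zx); rewrite leNgt (lt_trans Fx Fz).
rewrite leNgt; apply/negP => Fp.
have := cvgr_lt _ (@cumulative_is_right_continuous _ _ _ F (quantileR F p)) _ Fp.
move=> near_lt.
have [e /= e0 he] := near_lt.
have [z /= Fz zlt] := inf_adherent e0 hinf.
have qz : quantileR F p <= z by apply: ge_inf => //; exact: hinf.2.
move: qz; rewrite le_eqVlt => /orP[/eqP qz|qz].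
  by move: Fp; rewrite qz ltNge (ltW Fz).
have := he z; rewrite /= => /(_ _ qz) hz.
have : F z < p by apply: hz; rewrite ltr0_norm ?subr_lt0// opprB ltrBlDl.
by rewrite ltNge (ltW Fz).
Qed.

Lemma cdf_lt_quantileL (R : realType) (F : cumulativeBounded (0 : R) (1 : R))
    (p x : R) :
  0 < p -> x < quantileL F p -> F x < p.
Proof.
move=> p0; apply: contraTT; rewrite -!leNgt => Fx; apply: ge_inf => //.
have [y Fy] := filter_ex (cvgr_lt _ (cumulativeNy F) _ p0).
exists y => z /= Fz; rewrite leNgt; apply/negP => zy.
by have := cumulative_is_nondecreasing F _ _ (ltW zy); rewrite leNgt (lt_le_trans Fy Fz).
Qed.

(** * Order statistics and the empirical median *)

Lemma count_codom (I : finType) (E : Type) (a : pred E) (x : I -> E) :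
  count a (codom x) = #|[set i | a (x i)]%SET|.
Proof. by rewrite count_map enumT cardsE cardE /enum_mem size_filter. Qed.

Lemma count_sorted_sample (R : realType) (n : nat) (x : 'I_n -> R) (a : pred R) :
  count a (sort <=%R (codom x)) = #|[set i | a (x i)]%SET|.
Proof. by rewrite count_sort count_codom. Qed.

Lemma size_sorted_sample (R : realType) (n : nat) (x : 'I_n -> R) :
  size (sort <=%R (codom x)) = n.
Proof. by rewrite size_sort size_codom card_ord. Qed.

(** By contraposition: if more than half of the sample is [<= q], these values fill an initial
    segment of the sorted sample that contains every middle position. *)
Lemma empirical_median_gt (R : realType) (n : nat) (x : 'I_n -> R) (q : R) :
  q < empirical_median x -> (2 * #|[set i | (x i <= q)%R]%SET| <= n)%N.
Proof.
have ss := sort_le_sorted (codom x).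
have := count_sorted_sample R n x (<= q).
rewrite /empirical_median; set s := sort _ _ in ss * => <-.
set c := count _ s.
have nthq i : (i < c)%N -> s`_i <= q by exact: nth_count_le.
apply: contraTT; rewrite -ltnNge -leNgt => nc.
have h : s`_(n./2) <= q by apply: nthq; lia.
case: ifP => // nodd.
have h' : s`_(n./2.-1) <= q by apply: nthq; lia.
lra.
Qed.

Lemma empirical_median_lt (R : realType) (n : nat) (x : 'I_n -> R) (q : R) :
  empirical_median x < q -> (2 * #|[set i | (q <= x i)%R]%SET| <= n)%N.
Proof.
have ss := sort_le_sorted (codom x).
have := count_sorted_sample R n x (>= q).
have := size_sorted_sample R n x.
rewrite /empirical_median; set s := sort _ _ in ss * => sn <-.
set c := count _ s.
have nthq i : (n - c <= i < n)%N -> q <= s`_i.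
  by rewrite -sn /c -count_lt_ge; exact: nth_count_ge.
have cn : (c <= n)%N by rewrite -sn count_size.
apply: contraTT; rewrite -ltnNge -leNgt => nc.
have h : q <= s`_(n./2) by apply: nthq; lia.
(* For even [n], [n < 2 * c] forces [c] to be at least [n./2 + 1], so the lower middle index
   [n./2.-1] is still among the last [c] positions. *)
case: ifP => // nodd.
have h' : q <= s`_(n./2.-1) by apply: nthq; lia.
lra.
Qed.

(** Open right rays generate the Borel sets, and the entry of index [k < n] exceeds [r] exactly when
    at most [k] sample values are [<= r], which is an event about a count. *)
Lemma measurable_order_statistic (R : realType) (d : measure_display)
    (T : measurableType d) (n : nat) (X : 'I_n -> T -> R) (k : nat) :
  (forall i, measurable_fun setT (X i)) ->
  measurable_fun setT (fun w => (sort <=%R (codom (fun i => X i w)))`_k).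
Proof.
move=> mX.
(* Past the end of the sample the entry is the default value 0, a constant function. *)
have [nk|kn] := leqP n k.
  rewrite [X in measurable_fun _ X](_ : _ = cst 0)//; apply/funext => w.
  by rewrite nth_default// size_sorted_sample.
apply: (measurability _ (RGenOInfty.measurableE R)) => _ [_ [r ->] <-].
rewrite setTI.
rewrite [X in measurable X](_ : _ =
    [set w | (#|[set i | w \in X i @^-1` `]-oo, r]]%SET| <= k)%N]).
  apply: (measurable_card _ _ _ _ (fun c => c <= k)%N) => i.
  by rewrite -[X in measurable X]setTI; apply: mX => //; exact: measurable_itv.
apply/funext => w; apply/propext => /=.
have -> : [set i | w \in X i @^-1` `]-oo, r]]%SET = [set i | X i w <= r]%SET.
  apply/setP => i; rewrite inE [RHS]inE.
  by apply/idP/idP => [/set_mem|Xr]; [|apply/mem_set]; rewrite /= in_itv.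
have ss := sort_le_sorted (codom (fun i => X i w)).
have := count_sorted_sample R n (fun i => X i w) (<= r).
have := size_sorted_sample R n (fun i => X i w).
set s := sort _ _ in ss * => sn <-; rewrite in_itv /= andbT.
split; last by move=> ck; apply: nth_count_gt => //; rewrite ck sn.
by apply: contraTT; rewrite -leNgt -ltnNge; exact: nth_count_le.
Qed.

Lemma measurable_empirical_median (R : realType) (d : measure_display)
    (T : measurableType d) (n : nat) (X : 'I_n -> T -> R) :
  (forall i, measurable_fun setT (X i)) ->
  measurable_fun setT (fun w => empirical_median (fun i => X i w)).
Proof.
move=> mX; rewrite /empirical_median.
case: (odd n); first exact: measurable_order_statistic.
apply: measurable_funM => //.
by apply: measurable_funD; exact: measurable_order_statistic.
Qed.

(** * Counting uncontaminated observations *)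

(** The open ray is the increasing union of the closed rays ending at [q - k.+1%:R^-1], so
    continuity from below carries the cdf bound over to it. *)
Lemma probability_lt_le (R : realType) (d : measure_display)
    (T : measurableType d) (P : probability T R) (Y : {RV P >-> R}) (q p : R) :
  (forall x, x < q -> (cdf Y x <= p%:E)%E) ->
  (P (Y @^-1` `]-oo, q[) <= p%:E)%E.
Proof.
move=> cdf_le.
pose A k := Y @^-1` `]-oo, q - k.+1%:R^-1].
have mA k : measurable (A k) by exact: measurable_funPTI.
have -> : Y @^-1` `]-oo, q[ = \bigcup_k A k.
  apply/seteqP; split=> [w|w [k _]]; rewrite /A /= !in_itv /=.
    by move=> /ltr_add_invr[k /ltW]; exists k => //=; rewrite in_itv /= lerBrDr.
  by move=> /le_lt_trans; apply; rewrite ltrBlDr ltrDl invr_gt0.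
have Acvg : P (A k) @[k --> \oo] --> P (\bigcup_k A k).
  apply: nondecreasing_cvg_mu => // [|k l kl]; first exact: bigcup_measurable.
  apply/subsetPset => w; rewrite /A /= !in_itv /= => /le_trans; apply.
  by rewrite lerD2l lerN2 lef_pV2 ?posrE// ler_nat.
rewrite -(cvg_lim _ Acvg)//; apply: lime_le; first by apply/cvg_ex; eexists; exact: Acvg.
by apply: nearW => k; apply: cdf_le; rewrite ltrBlDr ltrDl invr_gt0.
Qed.

Lemma few_uncontaminated_in (R : realType) (d : measure_display)
    (T : measurableType d) (P : probability T R) (n : nat)
    (Y : 'I_n -> {RV P >-> R}) (D : 'I_n -> {RV P >-> bool})
    (A : set R) (eps h : R) :
  0 <= eps <= 1 -> 0 <= h < 1 / 2 -> measurable A ->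
  independent_two_families Y D ->
  (forall i, distribution P (D i) =1 bernoulli_prob eps) ->
  (forall i, ((1 / 2 + h)%:E <= (1 - eps)%:E * P (Y i @^-1` A))%E) ->
  (P [set w | (2 * #|[set i | w \in Y i @^-1` A `&` D i @^-1` [set false]]%SET|
               <= n)%N] <=
   (expR (- (2 * h ^+ 2 * n%:R)))%:E)%E.
Proof.
move=> eps01 hh mA indYD distD pge.
pose B i := Y i @^-1` A `&` D i @^-1` [set false].
have mB i : measurable (B i).
  by apply: measurableI; exact: measurable_funPTI.
have PD i : P (D i @^-1` [set false]) = (1 - eps)%:E.
  rewrite -[LHS]/(distribution P (D i) _) distD bernoulli_probE//.
  rewrite !diracE (memNset (u := true))// (mem_set (u := false))//=.
  by rewrite mule0 mule1 add0e.
have PBJ (J : {set 'I_n}) : (P (\bigcap_(i in [set` J]) B i) =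
    \prod_(i in J) ((1 - eps)%:E * P (Y i @^-1` A)))%E.
  (* Each [B i] splits into a [Y]-event and a [D]-event. Indexing both by the sum type lets joint
     independence factor the whole intersection at once. *)
  pose C (k : 'I_n + 'I_n) := match k with
    | inl i => Y i @^-1` A | inr i => D i @^-1` [set false] end.
  pose K := [set k : 'I_n + 'I_n |
    match k with inl i => i \in J | inr i => i \in J end]%SET.
  have -> : \bigcap_(i in [set` J]) B i = \bigcap_(k in [set` K]) C k.
    apply/seteqP; split=> w wB.
      by case=> i; rewrite /= inE => /wB[].
    by move=> i iJ; split; [apply: (wB (inl i))|apply: (wB (inr i))];
      rewrite /= inE.
  rewrite indYD; last first.
    case=> j _ /=; [exists A|exists [set false]] => //; exact: setTI.
  rewrite big_sumType big_split /= muleC; congr (_ * _)%E.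
    by under eq_bigl do rewrite inE; apply: eq_bigr => i _; rewrite /C PD.
  by under eq_bigl do rewrite inE.
have PB i : P (B i) = ((1 - eps)%:E * P (Y i @^-1` A))%E.
  have := PBJ [set i]%SET; rewrite big_set1 => <-; congr (P _).
  apply/seteqP; split=> [w wB j|w]; first by rewrite /= inE => /eqP ->.
  by apply; rewrite /= inE.
have indB : independent_systems P (fun i => [set B i]).
  move=> J A' A'E.
  rewrite (_ : \bigcap_(i in _) A' i = \bigcap_(i in [set` J]) B i).
    by rewrite PBJ; apply: eq_bigr => i /A'E ->; rewrite PB.
  by apply: eq_bigcapr => i; exact: A'E.
have PBge i : ((1 / 2 + h)%:E <= P (B i))%E by rewrite PB.
have := few_independent_events _ _ _ P _ B h hh mB indB PBge.
by rewrite card_ord.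
Qed.

(** * The deviation event and its probability *)

(** [M] may be uncountable, so measurability comes from topology: the set is an intersection of
    closed intervals, hence closed. *)
Lemma measurable_sup_dist_le (R : realType) (M : set R) (r : R) :
  measurable [set x : R | (ereal_sup [set `|x - m|%:E | m in M] <= r%:E)%E].
Proof.
rewrite [X in measurable X](_ : _ = \bigcap_(m in M) [set` `[m - r, m + r]]).
  by apply: closed_measurable; apply: closed_bigI => m _; exact: itv_closed.
apply/seteqP; split=> [x /ereal_supP h m Mm|x h] /=.
  have := h _ (imageP (fun m => `|x - m|%:E) Mm).
  by rewrite lee_fin ler_distl in_itv.
apply/ereal_supP => _ [m /h hm <-].
by move: hm; rewrite lee_fin ler_distl /= in_itv.
Qed.

Theorem lemma6 (R : realType) (tb eps : R) (rad : R -> R)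
    (F : cumulativeBounded (0 : R) (1 : R))
    (d : measure_display) (T : measurableType d) (P : probability T R)
    (n : nat) (delta : R)
    (Y : 'I_n -> {RV P >-> R}) (D : 'I_n -> {RV P >-> bool})
    (Z : 'I_n -> {RV P >-> R}) (X : 'I_n -> T -> R) :
  0 < tb < 1 / 2 ->
  0 < eps < 2 * tb / (1 + 2 * tb) ->
  (forall t, 0 <= t <= tb -> 0 <= rad t) ->
  (forall s t, 0 <= s -> s <= t -> t <= tb -> rad s <= rad t) ->
  quantile_class tb rad F ->
  (forall i x, cdf (Y i) x = (F x)%:E) ->
  (forall i, distribution P (D i) =1 bernoulli_prob eps) ->
  independent_two_families Y D ->
  (forall i w, X i w = (1 - (D i w)%:R) * Y i w + (D i w)%:R * Z i w) ->
  0 < delta < 1 ->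
  2 * (tb - eps / (2 * (1 - eps))) ^- 2 * ln (2 / delta) <= n%:R ->
  ((1 - delta)%:E <=
   P [set w | ereal_sup [set `|empirical_median (fun i => X i w) - m|%:E
                        | m in medians F]
        <= (rad (eps / (2 * (1 - eps))
                 + Num.sqrt (2 * ln (2 / delta) / n%:R)))%:E])%E.
Proof.
move=> /andP[tb0 tb2] /andP[eps0 epstb] rad0 radmono HF cdfY distD indYD XE
  /andP[delta0 delta1] nge.
pose e := eps / (2 * (1 - eps)); pose L := ln (2 / delta).
have eps2 : eps < 1 / 2.
  by apply: lt_le_trans epstb _; rewrite ler_pdivrMr; lra.
have eE : 2 * (1 - eps) * e = eps by rewrite /e; field; lra.
have e0 : 0 <= e by rewrite divr_ge0; lra.
(* This is the upper bound on [eps] rearranged; it leaves room for [s] below [tb - e]. *)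
have etb : e < tb.
  rewrite ltr_pdivlMr in epstb; last lra.
  by rewrite ltr_pdivrMr; lra.
have L0 : 0 < L by rewrite ln_gt0// ltr_pdivlMr//; lra.
have gap0 : 0 < (tb - e) ^+ 2 by rewrite exprn_gt0// subr_gt0.
have n0 : 0 < n%:R :> R.
  apply: lt_le_trans nge; rewrite !mulr_gt0// invr_gt0//.
pose s := Num.sqrt (2 * L / n%:R).
have s0 : 0 <= s by exact: sqrtr_ge0.
have s2 : s ^+ 2 = 2 * L / n%:R.
  by rewrite sqr_sqrtr// divr_ge0//; lra.
(* The sample size condition, squared; it keeps [t] in the range where [quantile_class] gives a
   bound. *)
have stb : s <= tb - e.
  rewrite -(@ler_pXn2r _ 2)// ?nnegrE ?subr_ge0 ?(ltW etb)//.
  rewrite s2 ler_pdivrMr//.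
  have := nge; rewrite -/e -/L mulrAC ler_pdivrMr//; lra.
pose t := e + s.
rewrite -/e -/L -/s -/t.
have t0 : 0 <= t by exact: addr_ge0.
have ttb : t <= tb by rewrite /t; lra.
pose h := (1 - eps) * s.
have h0 : 0 <= h by apply: mulr_ge0 => //; lra.
(* Since [(1 - eps) * e = eps / 2], the shift [e] exactly offsets the mass lost to contamination,
   and only [(1 - eps) * s] remains above one half. *)
have hE : 1 / 2 + h = (1 - eps) * (1 / 2 + t).
  by rewrite /h /t; lra.
have h2 : h < 1 / 2 by nra.
have tailE : expR (- (2 * h ^+ 2 * n%:R)) <= delta / 2.
  rewrite -[leRHS]invf_div -(@lnK _ (2 / delta)) ?posrE ?divr_gt0// -expRN.
  rewrite ler_expR lerN2 -/L.
  have -> : 2 * h ^+ 2 * n%:R = 4 * (1 - eps) ^+ 2 * L.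
    rewrite /h exprMn s2; field; lra.
  (* From [eps < 1 / 2] comes [4 * (1 - eps) ^+ 2 >= 1], so the exponent is at least [L]. *)
  by rewrite ler_peMl ?(ltW L0)//; nra.
pose qR := quantileR F (1 / 2 + t); pose qL := quantileL F (1 / 2 - t).
have eps01 : 0 <= eps <= 1 by apply/andP; split; lra.
have hh : 0 <= h < 1 / 2 by rewrite h0.
pose count_in A w := #|[set i | w \in Y i @^-1` A `&` D i @^-1` [set false]]%SET|.
have rare A : measurable A ->
    (forall i, ((1 / 2 + t)%:E <= P (Y i @^-1` A))%E) ->
    (P [set w | (2 * count_in A w <= n)%N] <= (delta / 2)%:E)%E.
  move=> mA PA.
  apply: le_trans (few_uncontaminated_in _ _ _ P n Y D A eps h eps01 hh mA indYD distD _) _.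
    move=> i; rewrite hE EFinM lee_pmul2l// lte_fin; lra.
  by rewrite lee_fin.
have rareR : (P [set w | (2 * count_in [set` `]-oo, qR]] w <= n)%N] <= (delta / 2)%:E)%E.
  apply: rare => // i; rewrite -[P _]/(cdf (Y i) qR) cdfY lee_fin.
  by apply: cdf_quantileR_ge; apply/andP; split; lra.
have rareL : (P [set w | (2 * count_in [set` `[qL, +oo[] w <= n)%N] <= (delta / 2)%:E)%E.
  apply: rare => // i.
  have -> : Y i @^-1` [set` `[qL, +oo[] = ~` (Y i @^-1` [set` `]-oo, qL[]).
    by rewrite preimage_setC setCitvl.
  rewrite probability_setC; last exact: measurable_funPTI.
  have : (P (Y i @^-1` [set` `]-oo, qL[]) <= (1 / 2 - t)%:E)%E.
    apply: probability_lt_le => x xq; rewrite cdfY lee_fin ltW//.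
    by apply: cdf_lt_quantileL => //; lra.
  rewrite -(fineK (fin_num_measure P (Y i @^-1` [set` `]-oo, qL[]) _)); last exact: measurable_funPTI.
  by rewrite -EFinB !lee_fin; lra.
have mX i : measurable_fun setT (X i).
  (* [D i] is boolean, so the mixture is a choice between [Z i] and [Y i]. *)
  have -> : X i = (fun w => if D i w then Z i w else Y i w).
    by apply/funext => w; rewrite XE; case: (D i w) => /=; lra.
  exact: measurable_fun_ifT.
set good := [set w | _].
have mgood : measurable good.
  have := measurable_empirical_median R d T n X mX.
  by move=> /(_ measurableT _ (measurable_sup_dist_le R (medians F) (rad t))); rewrite setTI.
have mfew A : measurable A -> measurable [set w | (2 * count_in A w <= n)%N].
  move=> mA; apply: (measurable_card _ _ _ _ (fun c => 2 * c <= n)%N) => i.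
  by apply: measurableI; exact: measurable_funPTI.
(* Where [D i] is false, [X i] equals [Y i], so [count_in A] is at most the number of [X i] in [A].
   Outside both rare events the median thus lies between [qL] and [qR], and the class bound applies
   to all medians [m] simultaneously. *)
have sub : ~` good `<=` [set w | (2 * count_in [set` `]-oo, qR]] w <= n)%N] `|`
                         [set w | (2 * count_in [set` `[qL, +oo[] w <= n)%N].
  move=> w; apply: contra_notP => /not_orP[/= /negP nR /negP nL].
  have XY i : D i w = false -> X i w = Y i w.
    by move=> Dw; rewrite XE Dw /=; lra.
  have leR : empirical_median (fun i => X i w) <= qR.
    rewrite leNgt; apply: contra nR => /empirical_median_gt; apply: leq_trans.
    rewrite leq_mul2l /=; apply: subset_leq_card; apply/fintype.subsetP => i.
    by rewrite inE [in X in _ -> X]inE => /set_mem[+ /XY ->]; rewrite /= in_itv.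
  have leL : qL <= empirical_median (fun i => X i w).
    rewrite leNgt; apply: contra nL => /empirical_median_lt; apply: leq_trans.
    rewrite leq_mul2l /=; apply: subset_leq_card; apply/fintype.subsetP => i.
    by rewrite inE [in X in _ -> X]inE => /set_mem[+ /XY ->]; rewrite /= in_itv /= andbT.
  apply/ereal_supP => _ [m Mm <-]; rewrite lee_fin ler_distl.
  have := HF t m _ Mm; rewrite t0 ttb => /(_ isT).
  by rewrite ge_max -/qR -/qL => /andP[h3 h4]; apply/andP; split; lra.
have -> : good = ~` ~` good by rewrite setCK.
rewrite probability_setC; last exact: measurableC.
rewrite EFinB leeB//.
rewrite [leRHS](_ : _ = (delta / 2)%:E + (delta / 2)%:E)%E; last first.
  by rewrite -EFinD -splitr.
apply: le_trans (leeD rareR rareL).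
apply: le_trans (measureU2 _ _ _); [|exact: mfew..].
apply: le_measure => //; rewrite inE; first exact: measurableC.
by apply: measurableU; exact: mfew.
Qed.
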